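(* Let $\mathcal M=(\mathcal D,x)$ be a time-like surface in $\mathbb R^4_2$ parametrized by isothermal coordinates $(u,v)\in\mathcal D$, and let $\Phi(t)=x_u+\mathrm j\,x_v$, $t=u+\mathrm jv$. Then the following three conditions are equivalent: (1) the function $\Phi(t)$ is holomorphic over $\mathbb D$: $\frac{\partial\Phi}{\partial\bar t}=0$; (2) the function $x(u,v)$ is hyperbolically harmonic: $\Delta^hx=x_{uu}-x_{vv}=0$; (3) $\mathcal M=(\mathcal D,x)$ is a minimal time-like surface in $\mathbb R^4_2$: $H=0$.
   Context: All maps are smooth; $\mathcal D\subset\mathbb R^2$ is a domain (open, connected). $\mathbb R^4_2$ is $\mathbb R^4$ with scalar product $a\cdot b=-a_1b_1+a_2b_2-a_3b_3+a_4b_4$; $a^2=a\cdot a$. Double numbers: $\mathbb D=\{t=u+\mathrm jv:u,v\in\mathbb R\}$ with $\mathrm j^2=1$; $\mathbb R^2$ is identified with $\mathbb D$; $\frac{\partial}{\partial\bar t}=\frac12(\frac{\partial}{\partial u}-\mathrm j\frac{\partial}{\partial v})$. $\Phi$ takes values in $\mathbb D^4$. A time-like surface $(\mathcal D,x)$ is an immersion $x:\mathcal D\to\mathbb R^4_2$ whose induced scalar product on tangent planes is indefinite (signature $(1,1)$). Coordinates $(u,v)$ are isothermal if $x_u^2=-x_v^2$ and $x_u\cdot x_v=0$; always with $E=x_u^2<0$. The mean curvature vector is $H=\frac12(-\sigma(X_1,X_1)+\sigma(X_2,X_2))$, where $\sigma$ is the second fundamental form and $(X_1,X_2)$ is an orthonormal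 tangent frame with $X_1^2=-1$, $X_2^2=1$. *)

(* Defs.v *)
From HB Require Import structures.
From mathcomp Require Import all_boot all_order all_algebra.
From mathcomp Require Import all_classical all_reals all_analysis.
From mathcomp Require Import ring.

Set Implicit Arguments.
Unset Strict Implicit.
Unset Printing Implicit Defensive.
Import Order.TTheory GRing.Theory Num.Theory.
Import numFieldNormedType.Exports.

Local Open Scope classical_set_scope.
Local Open Scope ring_scope.

(* The pair (u, v) stands for the double number u + j v.  As a normed space
   over R this is R * R; the multiplication is not the componentwise one. *)
Definition dblnum (R : realType) : Type := (R * R)%type.

HB.instance Definition _ (R : realType) :=
  NormedModule.copy (dblnum R) (R * R)%type.

Section DoubleRing.
Variable R : realType.
Implicit Types s t w : dblnum R.

Definition dbl_one : dblnum R := (1, 0).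

Definition dbl_mul s t : dblnum R :=
  (s.1 * t.1 + s.2 * t.2, s.1 * t.2 + s.2 * t.1).

Lemma dbl_mulA : associative dbl_mul.
Proof.
by move=> [a b] [c d] [e f]; rewrite /dbl_mul /=; congr pair; ring.
Qed.

Lemma dbl_mulC : commutative dbl_mul.
Proof. by move=> [a b] [c d]; rewrite /dbl_mul /=; congr pair; ring. Qed.

Lemma dbl_mul1 : left_id dbl_one dbl_mul.
Proof. by move=> [a b]; rewrite /dbl_mul /=; congr pair; ring. Qed.

Lemma dbl_mulD : left_distributive dbl_mul +%R.
Proof.
move=> [a b] [c d] [e f]; have E1 : (a + c) * e + (b + d) * f = a * e + b * f + (c * e + d * f) by ring.
have E2 : (a + c) * f + (b + d) * e = a * f + b * e + (c * f + d * e) by ring.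
exact: (f_equal2 pair E1 E2).
Qed.

Lemma dbl_one_neq0 : dbl_one != 0.
Proof. by apply/eqP => -[/eqP]; rewrite oner_eq0. Qed.

HB.instance Definition _ := GRing.Zmodule_isComNzRing.Build (dblnum R)
  dbl_mulA dbl_mulC dbl_mul1 dbl_mulD dbl_one_neq0.

Lemma dbl_scaleAl (a : R) s t : a *: (s * t) = (a *: s : dblnum R) * t.
Proof.
case: s t => [b c] [d e].
have E1 : a * (b * d + c * e) = a * b * d + a * c * e by ring.
have E2 : a * (b * e + c * d) = a * b * e + a * c * d by ring.
exact: (f_equal2 pair E1 E2).
Qed.

HB.instance Definition _ :=
  GRing.Lmodule_isLalgebra.Build R (dblnum R) dbl_scaleAl.
HB.instance Definition _ :=
  GRing.Lalgebra_isComAlgebra.Build R (dblnum R).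

Definition dbl_j : dblnum R := (0, 1).

Definition dbl_of (a : R) : dblnum R := (a, 0).

Lemma dbl_jj : dbl_j * dbl_j = 1.
Proof.
by rewrite /GRing.mul /= /dbl_mul /= !mul0r mulr0 mulr1 !add0r.
Qed.

End DoubleRing.

Arguments dbl_j {R}.
Notation "''j'" := dbl_j : ring_scope.

Section Calculus.
Variables (R : realType) (W : normedModType R).
Implicit Types (D : set (dblnum R)) (f : dblnum R -> W).

(* R^2 is identified with the double numbers, so the coordinate directions
   are 1 = (1, 0) and j = (0, 1). *)
Definition partial_u f : dblnum R -> W := 'D_(1 : dblnum R) f.
Definition partial_v f : dblnum R -> W := 'D_('j : dblnum R) f.

Definition hyperbolic_laplacian f (t : dblnum R) : W :=
  partial_u (partial_u f) t - partial_v (partial_v f) t.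

(* f is infinitely (Frechet) differentiable on the open set D. *)
Definition smooth_on D f : Prop :=
  forall (vs : seq (dblnum R)) (t : dblnum R), D t ->
    differentiable (foldr (fun v g => 'D_v g) f vs) t.

End Calculus.

Section Surfaces.
Variable R : realType.
Implicit Types (D : set (dblnum R)) (x : dblnum R -> 'rV[R]_4).
Implicit Types (t xi eta : dblnum R) (X Y : dblnum R -> dblnum R).

(* diag (-1, 1, -1, 1) *)
Definition metric_mx : 'M[R]_4 := diag_mx (\row_(i < 4) (-1) ^+ i.+1).

Definition dot (a b : 'rV[R]_4) : R := (a *m metric_mx *m b^T) 0 0.

Definition induced x t xi eta : R := dot ('d x t xi) ('d x t eta).

(* The frame consists of the tangent vectors 'd x t xi and 'd x t eta. *)
Definition orthonormal_frame x t xi eta : Prop :=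
  [/\ induced x t xi xi = -1, induced x t eta eta = 1
    & induced x t xi eta = 0].

(* The last clause says that the induced scalar product on the (2-dimensional)
   tangent plane has signature (1, 1). *)
Definition timelike_surface D x : Prop :=
  smooth_on D x /\
  forall t, D t ->
    injective ('d x t) /\ exists xi eta, orthonormal_frame x t xi eta.

Definition isothermal D x : Prop :=
  forall t, D t ->
    [/\ dot (partial_u x t) (partial_u x t) < 0,
        dot (partial_u x t) (partial_u x t)
          = - dot (partial_v x t) (partial_v x t)
      & dot (partial_u x t) (partial_v x t) = 0].

(* Subspaces of R^4 are represented as row spaces of matrices. *)
Definition tangent_plane x t : 'M[R]_4 := (partial_u x t + partial_v x t)%MS.

Definition normal_plane x t : 'M[R]_4 :=
  kermx (metric_mx *m (tangent_plane x t)^T).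

(* X and Y are fields on the parameter domain, representing the tangent fields
   s |-> 'd x s (X s) and s |-> 'd x s (Y s) along the surface; the flat
   derivative of the second one along the first one is projected onto the
   normal plane, parallel to the tangent plane (Gauss formula). *)
Definition second_fundamental_form x X Y t : 'rV[R]_4 :=
  'D_(X t) (fun s => 'd x s (Y s)) t
    *m proj_mx (normal_plane x t) (tangent_plane x t).

Definition mean_curvature x X1 X2 t : 'rV[R]_4 :=
  2^-1 *: (- second_fundamental_form x X1 X1 t
           + second_fundamental_form x X2 X2 t).

(* The mean curvature vector at t does not depend on the frame, and since the
   second fundamental form is tensorial the fields X1, X2 extending the frame
   need to be orthonormal only at t.  Frames exist at every point of a
   time-like surface, and extend by constant fields. *)
Definition minimal_timelike_surface D x : Prop :=
  timelike_surface D x /\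
  forall X1 X2 t, smooth_on D X1 -> smooth_on D X2 -> D t ->
    orthonormal_frame x t (X1 t) (X2 t) -> mean_curvature x X1 X2 t = 0.

Definition Phi x t : 'rV[dblnum R]_4 :=
  map_mx (@dbl_of R) (partial_u x t)
    + 'j *: map_mx (@dbl_of R) (partial_v x t).

Definition wirtinger_bar (f : dblnum R -> dblnum R) t : dblnum R :=
  2^-1 *: (partial_u f t - 'j * partial_v f t).

Definition holomorphic_on D (F : dblnum R -> 'rV[dblnum R]_4) : Prop :=
  forall t, D t -> \row_i wirtinger_bar (fun s => F s 0 i) t = 0.

Definition hyperbolically_harmonic D x : Prop :=
  forall t, D t -> hyperbolic_laplacian x t = 0.

End Surfaces.

(* Main.v *)
Require Import Defs.
From mathcomp Require Import all_boot all_order all_algebra.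
From mathcomp Require Import all_classical all_reals all_analysis.
From mathcomp Require Import ring lra.

Set Implicit Arguments.
Unset Strict Implicit.
Unset Printing Implicit Defensive.
Import Order.TTheory GRing.Theory Num.Theory.
Import numFieldNormedType.Exports.

Local Open Scope classical_set_scope.
Local Open Scope ring_scope.

(** Write E = x_u^2 < 0, so that x_v^2 = -E and x_u . x_v = 0, and let N be
the projection onto the normal plane along the tangent plane.

Holomorphic and harmonic: the i-th coordinate of Phi is the double number x_u + j x_v, and
d Phi / d tbar = 1/2 ((x_uu - x_vv) + j (x_vu - x_uv)).  The second part
vanishes because mixed partial derivatives commute, so the whole vanishes
exactly when the hyperbolic Laplacian does ([wirtinger_barPhi]).

Harmonic and minimal: the second fundamental form is a quadratic expression in the
normal parts of x_uu, x_uv and x_vv ([second_fundamental_formE]), since the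
derivatives of the coefficients of a tangent field contribute tangent vectors
only.  Its trace over any orthonormal frame gives H = N (x_uu - x_vv) / (2 E)
([mean_curvatureE]), so harmonic maps are minimal.  Conversely H = 0 says that
x_uu - x_vv is tangent.  Differentiating the two isothermality relations along
u and v shows that x_uu - x_vv is also orthogonal to x_u and x_v
([laplacian_ortho]); as the scalar product is nondegenerate on the tangent
plane, x_uu - x_vv = 0.

Both halves use the symmetry of second derivatives.  It is obtained in Young's
form ([derive_swap_real]): the second difference of f along h u and h v,
divided by h^2, tends to D_v D_u f, and it is symmetric in u and v. *)

(** * Symmetry of mixed derivatives *)

Lemma is_derive_line (R : realType) (V : normedModType R) (f : V -> R)
    (w u : V) (s df : R) : is_derive (s *: u + w) u f df ->
  is_derive s (1 : R) (fun r : R => f (r *: u + w)) df.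
Proof.
move=> [fd <-].
have E : (fun h : R => h^-1 *: (((fun r : R => f (r *: u + w)) \o shift s)
      (h *: (1 : R)) - f (s *: u + w)))
    = (fun h : R => h^-1 *: ((f \o shift (s *: u + w)) (h *: u)
      - f (s *: u + w))).
  apply/funext => h; congr (_ *: (_ - _)) => /=.
  by rewrite scalerDl addrA [h *: 1]mulr1.
by split; rewrite /derivable /derive E.
Qed.

(** The mean value theorem along u turns the second difference into h times an
increment of g along h v, up to the point c u with 0 < c < h; differentiability
of g at the single point a is then enough to control that increment. *)
Lemma second_difference_cvg (R : realType) (V : normedModType R) (f g : V -> R)
    (a u v : V) :
  (\forall s \near a, is_derive s u f (g s)) -> differentiable g a ->
  h^-1 * h^-1 * (f (h *: u + (h *: v + a)) - f (h *: u + a)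
    - (f (h *: v + a) - f a)) @[h --> (0 : R)^'+] --> 'D_v g a.
Proof.
move=> fd gd.
apply/cvgrPdist_le => e e0.
(* The error is at most eta (|c u + h v| + |c u|) <= eta (2 |u| + |v|) h when g
   is differentiable up to eta |k|; the summand 1 makes C positive. *)
pose C := 2 * `|u| + `|v| + 1.
have C0 : 0 < C by rewrite /C ltr_wpDl // addr_ge0 // mulr_ge0.
have eC0 : 0 < e / C by rewrite divr_gt0.
have gC : \forall k \near (0 : V),
    `|g (k + a) - g a - 'd g a k| <= e / C * `|k|.
  have := diff_locally gd; move/eqaddoP => /(_ _ eC0).
  apply: filterS => k /=.
  by move=> H; rewrite -addrA -opprD.
have fC : \forall k \near (0 : V), is_derive (k + a) u f (g (k + a)).
  by move: fd; rewrite (near_shift 0) /= subr0.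
have /nbhs_ballP[r /= r0 rP] : \forall k \near (0 : V),
    `|g (k + a) - g a - 'd g a k| <= e / C * `|k| /\ is_derive (k + a) u f (g (k + a)).
  by near=> k; split; near: k.
have small h c : 0 < h -> h < r / C -> 0 <= c <= h ->
    ball 0 r (c *: u + h *: v) /\ ball 0 r (c *: u).
  move=> h0 hr /andP[c0 ch]; rewrite -ball_normE /= !sub0r !normrN.
  have hC : h * C < r by rewrite -ltr_pdivlMr.
  have cu : `|c *: u| <= h * `|u| by rewrite normrZ ger0_norm // ler_wpM2r.
  have hv : `|h *: v| = h * `|v| by rewrite normrZ gtr0_norm.
  have hu0 : 0 <= h * `|u| by rewrite mulr_ge0 // ltW.
  have hv0 : 0 <= h * `|v| by rewrite mulr_ge0 // ltW.
  have hCE : h * C = 2 * (h * `|u|) + h * `|v| + h by rewrite /C; ring.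
  split; last by lra.
  by apply: le_lt_trans (ler_normD _ _) _; lra.
near=> h.
have h0 : 0 < h by near: h; exact: nbhs_right_gt.
have hr : h < r / C by near: h; apply: nbhs_right_lt; rewrite divr_gt0.
pose phi (s : R) := f (s *: u + (h *: v + a)) - f (s *: u + a).
have phid s : 0 <= s <= h -> is_derive s (1 : R) phi
    (g (s *: u + (h *: v + a)) - g (s *: u + a)).
  move=> sh; have [b1 b2] := small h s h0 hr sh.
  apply: is_deriveB; apply: is_derive_line.
    by rewrite addrA; case: (rP _ b1).
  by case: (rP _ b2).
have [c ch phiE] : exists2 c, c \in `]0, h[%R &
    phi h - phi 0 = (g (c *: u + (h *: v + a)) - g (c *: u + a)) * (h - 0).
  apply: (@MVT _ phi (fun c => g (c *: u + (h *: v + a)) - g (c *: u + a))) => //.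
    by move=> s; rewrite in_itv /= => /andP[s0 sh]; apply: phid; rewrite !ltW.
  apply: derivable_within_continuous => s; rewrite in_itv /= => sh.
  by have [] := phid s sh.
have {}ch : 0 <= c <= h by move: ch; rewrite in_itv /= => /andP[/ltW -> /ltW].
have [b1 b2] := small h c h0 hr ch.
have [+ _] := rP _ b1; have [+ _] := rP _ b2.
have -> : f (h *: u + (h *: v + a)) - f (h *: u + a) - (f (h *: v + a) - f a)
   = (g (c *: u + (h *: v + a)) - g (c *: u + a)) * h.
  by move: phiE; rewrite /phi !scale0r !add0r subr0.
have dgu k : 'd g a (k *: u) = k * 'd g a u by rewrite linearZ.
have dgv k : 'd g a (k *: v) = k * 'd g a v by rewrite linearZ.
rewrite addrA linearD dgu dgv deriveE //.
set G1 := g (_ + _ + a); set G2 := g (_ + a); set G0 := g a.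
set du := 'd g a u; set dv := 'd g a v => B2 B1.
have B : `|h * dv - (G1 - G2)| <= e * h.
  have -> : h * dv - (G1 - G2)
    = (G2 - G0 - c * du) - (G1 - G0 - (c * du + h * dv)).
    by ring.
  apply: le_trans (ler_normB _ _) _.
  apply: le_trans (lerD B2 B1) _.
  rewrite -mulrDr -mulrA ler_pM2l // ler_pdivrMl //.
  have cu : `|c *: u| <= h * `|u|.
    by case/andP: ch => c0 ch; rewrite normrZ ger0_norm // ler_wpM2r.
  have hv : `|h *: v| = h * `|v| by rewrite normrZ gtr0_norm.
  have := ler_normD (c *: u) (h *: v).
  have -> : C * h = 2 * (h * `|u|) + h * `|v| + h by rewrite /C; ring.
  lra.
have -> : dv - h^-1 * h^-1 * ((G1 - G2) * h) = h^-1 * (h * dv - (G1 - G2)).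
  by field; rewrite gt_eqF.
rewrite normrM gtr0_norm ?invr_gt0 // mulrC ler_pdivrMr //.
Unshelve. all: by end_near. Qed.

(** Young's theorem: both mixed derivatives are the limit of one and the same
second difference, computed by the mean value theorem along u or along v. *)
Lemma derive_swap_real (R : realType) (V : normedModType R) (f fu fv : V -> R)
    (a u v : V) :
  (\forall s \near a, is_derive s u f (fu s)) ->
  (\forall s \near a, is_derive s v f (fv s)) ->
  differentiable fu a -> differentiable fv a -> 'D_v fu a = 'D_u fv a.
Proof.
move=> fud fvd ud vd.
pose S p q (h : R) := h^-1 * h^-1 * (f (h *: p + (h *: q + a))
  - f (h *: p + a) - (f (h *: q + a) - f a)).
have Svu : S v u = S u v.
  apply/funext => h; rewrite /S !addrA [h *: v + h *: u]addrC.
  by congr (_ * _); ring.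
have Su : S u v @ (0 : R)^'+ --> 'D_v fu a by exact: second_difference_cvg.
have Sv : S v u @ (0 : R)^'+ --> 'D_u fv a by exact: second_difference_cvg.
rewrite Svu in Sv; apply: cvg_unique Su Sv.
exact: norm_hausdorff.
Qed.

Lemma derive_coord (R : realType) (V : normedModType R) m n
    (f : V -> 'M[R]_(m, n)) (a v : V) i j :
  derivable f a v -> is_derive a v (fun s => f s i j) (('D_v f a) i j).
Proof.
move=> fd; split; first by have /derivable_mxP := fd.
by rewrite derive_mx // mxE.
Qed.

Lemma differentiable_entry (R : realType) (V : normedModType R) m n
    (f : V -> 'M[R]_(m, n)) (a : V) i j :
  differentiable f a -> differentiable (fun s => f s i j) a.
Proof.
move=> fd; apply: (differentiable_comp fd (differentiable_coord _ i j)).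
Qed.

Lemma derive_swap (R : realType) (V : normedModType R) m n
    (f : V -> 'M[R]_(m, n)) (a u v : V) :
  (\forall s \near a, derivable f s u /\ derivable f s v) ->
  differentiable ('D_u f) a -> differentiable ('D_v f) a ->
  'D_v ('D_u f) a = 'D_u ('D_v f) a.
Proof.
move=> fd ud vd; apply/matrixP => i j.
have uvd : derivable ('D_u f) a v by exact: diff_derivable.
have vud : derivable ('D_v f) a u by exact: diff_derivable.
have [_ uvE] := derive_coord i j uvd; have [_ vuE] := derive_coord i j vud.
apply: etrans (esym uvE) _; apply: etrans vuE.
apply: (@derive_swap_real _ _ (fun s => f s i j)).
  by apply: filterS fd => s [fsu _]; exact: derive_coord.
by apply: filterS fd => s [_ fsv]; exact: derive_coord.
  exact: differentiable_entry.
exact: differentiable_entry.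
Qed.

(** * Leibniz rules for matrix-valued maps *)

Lemma is_derive_mx (R : realType) (V : normedModType R) m n
    (f : V -> 'M[R]_(m, n)) (df : 'M[R]_(m, n)) (a v : V) :
  (forall i j, is_derive a v (fun s => f s i j) (df i j)) -> is_derive a v f df.
Proof.
move=> fd; have fa : derivable f a v.
  by apply/derivable_mxP => i j; case: (fd i j).
split=> //; rewrite derive_mx //; apply/matrixP => i j; rewrite mxE.
by case: (fd i j).
Qed.

Lemma is_derive_scale (R : realType) (V : normedModType R) m n
    (k : V -> R) (f : V -> 'M[R]_(m, n)) (dk : R) (df : 'M[R]_(m, n)) (a v : V) :
  is_derive a v k dk -> is_derive a v f df ->
  is_derive a v (fun s => k s *: f s) (k a *: df + dk *: f a).
Proof.
move=> kd [fd fE]; apply: is_derive_mx => i j.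
have E1 : (fun s => (k s *: f s) i j) = k * (fun s => f s i j).
  by apply/funext => s; rewrite mxE.
have E2 : (k a *: df + dk *: f a) i j = k a *: df i j + f a i j *: dk.
  by rewrite !mxE [f a i j *: dk]mulrC.
rewrite E1 E2 -fE; apply: is_deriveM.
exact: derive_coord.
Qed.

(** * The scalar product of signature (2, 2) and the normal projection *)

Section Dot.
Variable R : realType.
Implicit Types a b c : 'rV[R]_4.

Lemma dotE a b : dot a b = \sum_(i < 4) (-1) ^+ i.+1 * (a 0 i * b 0 i).
Proof.
rewrite /dot /metric_mx mul_mx_diag mxE; apply: eq_bigr => i _.
by rewrite !mxE; ring.
Qed.

Lemma dotC a b : dot a b = dot b a.
Proof. by rewrite !dotE; apply: eq_bigr => i _; rewrite [a 0 i * _]mulrC. Qed.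

Lemma dotDl a b c : dot (a + b) c = dot a c + dot b c.
Proof. by rewrite /dot !mulmxDl mxE. Qed.

Lemma dotZl (k : R) a b : dot (k *: a) b = k * dot a b.
Proof. by rewrite /dot -!scalemxAl mxE. Qed.

Lemma dotDr a b c : dot c (a + b) = dot c a + dot c b.
Proof. by rewrite ![dot c _]dotC dotDl. Qed.

Lemma dotZr (k : R) a b : dot b (k *: a) = k * dot b a.
Proof. by rewrite ![dot b _]dotC dotZl. Qed.

Lemma is_derive_dot (V : normedModType R) (f g : V -> 'rV[R]_4) (t v : V)
    (df dg : 'rV[R]_4) : is_derive t v f df -> is_derive t v g dg ->
  is_derive t v (fun s => dot (f s) (g s)) (dot df (g t) + dot (f t) dg).
Proof.
move=> [fd fE] [gd gE].
have E1 : (fun s => dot (f s) (g s))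
    = \sum_(i < 4) ((-1) ^+ i.+1 *: ((fun s => f s 0 i) * (fun s => g s 0 i))).
  by apply/funext => s; rewrite dotE fct_sumE.
have E2 : dot df (g t) + dot (f t) dg
    = \sum_(i < 4) ((-1) ^+ i.+1 *: (f t 0 i *: dg 0 i + g t 0 i *: df 0 i)).
  rewrite !dotE -big_split; apply: eq_bigr => i _ /=.
  by rewrite /GRing.scale /=; ring.
rewrite E1 E2; apply: is_derive_sum => i; apply: is_deriveZ.
by rewrite -fE -gE; apply: is_deriveM; exact: derive_coord.
Qed.

(** The vectors p and q stand for x_u and x_v at a point. *)
Section Plane.
Variables p q : 'rV[R]_4.
Hypotheses (pp_lt0 : dot p p < 0) (pp_qq : dot p p = - dot q q).
Hypothesis pq0 : dot p q = 0.

Let T : 'M[R]_4 := (p + q)%MS.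
Let N : 'M[R]_4 := kermx (metric_mx R *m T^T).

Lemma sub_normal a : (a <= N)%MS = (dot a p == 0) && (dot a q == 0).
Proof.
have E (b : 'rV[R]_4) : (b <= kermx (a *m metric_mx R)^T)%MS = (dot a b == 0).
  rewrite sub_kermx -trmx_eq0 trmx_mul trmxK [a *m _ *m _]mx11_scalar.
  rewrite -/(dot a b); apply/eqP/eqP => [/matrixP/(_ 0 0)|->].
    by rewrite !mxE eqxx mulr1n.
  by rewrite raddf0.
rewrite sub_kermx -trmx_eq0 mulmxA trmx_mul trmxK -sub_kermx.
by rewrite addsmx_sub !E.
Qed.

(** The scalar product is nondegenerate on the plane spanned by p and q: they
form an orthogonal basis of it and neither of them is isotropic. *)
Lemma cap_normal_tangent : (N :&: T = 0)%MS.
Proof.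
have qq_neq0 : dot q q != 0 by rewrite -oppr_eq0 -pp_qq lt_eqF.
apply/eqP/rowV0P => a; rewrite sub_capmx sub_normal.
case/andP=> /andP[/eqP ap0 /eqP aq0] /sub_addsmxP[[b c] /= aE].
move: aE ap0 aq0; rewrite [b]mx11_scalar [c]mx11_scalar !mul_scalar_mx => ->.
rewrite !dotDl !dotZl [dot q p]dotC pq0 !mulr0 addr0 add0r => /eqP.
rewrite mulf_eq0 (lt_eqF pp_lt0) orbF => /eqP -> /eqP.
by rewrite mulf_eq0 (negPf qq_neq0) orbF => /eqP ->; rewrite !scale0r addr0.
Qed.

(** Subtracting from a its orthogonal projection onto the plane leaves a normal
vector; the minus sign in front of q comes from q^2 = - p^2. *)
Lemma add_normal_tangent a : (a <= N + T)%MS.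
Proof.
have pp_neq0 : dot p p != 0 by rewrite lt_eqF.
have qqE : dot q q = - dot p p by rewrite pp_qq opprK.
pose b := (dot a p / dot p p) *: p + - (dot a q / dot p p) *: q.
have aE : a = (a + (-1) *: b) + b by rewrite scaleN1r subrK.
have bT : (b <= T)%MS.
  by rewrite addmx_sub // scalemx_sub // ?addsmxSl ?addsmxSr.
rewrite aE; apply: addmx_sub_adds bT.
rewrite sub_normal !dotDl !dotZl !dotDl !dotZl [dot q p]dotC pq0 qqE.
by apply/andP; split; apply/eqP; field.
Qed.

Lemma normal_part_eq0 a : a *m proj_mx N T = 0 -> (a <= T)%MS.
Proof.
by move=> a0; have := proj_mx_compl_sub (add_normal_tangent a); rewrite a0 subr0.
Qed.

(** By [derive_velocity] the derivative of a tangent field has this shape, with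
second derivatives of the surface for a, b and c. *)
Lemma normal_part_mod_tangent (k l k1 k2 k3 : R) a b c :
  (k *: p + l *: q + (k1 *: a + k2 *: b + k3 *: c)) *m proj_mx N T
  = k1 *: (a *m proj_mx N T) + k2 *: (b *m proj_mx N T)
    + k3 *: (c *m proj_mx N T).
Proof.
have tan0 : (k *: p + l *: q) *m proj_mx N T = 0.
  apply: (proj_mx_0 cap_normal_tangent).
  by rewrite addmx_sub // scalemx_sub // ?addsmxSl ?addsmxSr.
by rewrite mulmxDl tan0 add0r !mulmxDl -!scalemxAl.
Qed.

(** Such a vector is tangent and normal at the same time. *)
Lemma normal_part_eq0_ortho a :
  a *m proj_mx N T = 0 -> dot a p = 0 -> dot a q = 0 -> a = 0.
Proof.
move=> /normal_part_eq0 aT ap0 aq0; apply/eqP.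
by rewrite -submx0 -cap_normal_tangent sub_capmx aT sub_normal ap0 aq0 eqxx.
Qed.

End Plane.
End Dot.

(** * Derivatives on the plane of double numbers *)

Section DoubleNumbers.
Variable R : realType.
Implicit Types (t z : dblnum R).

Lemma differentiable_partials (W : normedModType R) (f : dblnum R -> W) t z :
  differentiable f t ->
  'd f t z = z.1 *: partial_u f t + z.2 *: partial_v f t.
Proof.
move=> fd; rewrite /partial_u /partial_v !deriveE // -!linearZ -linearD.
congr ('d f t _); case: z => a b.
have E1 : a = a * 1 + b * 0 by ring.
have E2 : b = a * 0 + b * 1 by ring.
exact: (f_equal2 pair E1 E2).
Qed.

Lemma derive_partials (W : normedModType R) (f : dblnum R -> W) t z :
  differentiable f t ->
  is_derive t z f (z.1 *: partial_u f t + z.2 *: partial_v f t).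
Proof.
move=> fd; split; first exact: diff_derivable.
by rewrite deriveE // differentiable_partials.
Qed.

Lemma derivable_coordinates (f : dblnum R -> dblnum R) t z :
  derivable f t z ->
  derivable (fun s => (f s).1) t z /\ derivable (fun s => (f s).2) t z.
Proof.
move=> /cvg_ex[l fl]; split; apply/cvg_ex.
  exists l.1; exact: (cvg_comp _ fst fl (@cvg_fst _ _ (nbhs l.1) (nbhs l.2) _)).
exists l.2; exact: (cvg_comp _ snd fl (@cvg_snd _ _ (nbhs l.1) (nbhs l.2) _)).
Qed.

Lemma is_derive_pair (f g : dblnum R -> R) t z (df dg : R) :
  is_derive t z f df -> is_derive t z g dg ->
  is_derive t z (fun s => (f s, g s) : dblnum R) ((df, dg) : dblnum R).
Proof.
move=> [fd <-] [gd <-].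
have fg : (fun h : R => h^-1 *: (((fun s => (f s, g s) : dblnum R) \o shift t)
    (h *: z) - ((f t, g t) : dblnum R)))
    @ 0^' --> (('D_z f t, 'D_z g t) : dblnum R).
  exact: (cvg_pair (F := (0 : R)^') fd gd).
split; first by apply/cvg_ex; exists ('D_z f t, 'D_z g t).
by apply: cvg_lim fg; exact: norm_hausdorff.
Qed.

Lemma PhiE (x : dblnum R -> 'rV[R]_4) t i :
  Phi x t 0 i = (partial_u x t 0 i, partial_v x t 0 i).
Proof.
have pairE (a b : R) : dbl_of a + 'j * dbl_of b = (a, b).
  have E1 : a + (0 * b + 1 * 0) = a by ring.
  have E2 : 0 + (0 * 0 + 1 * b) = b by ring.
  exact: (f_equal2 pair E1 E2).
by rewrite /Phi !mxE pairE.
Qed.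

End DoubleNumbers.

(** * Isothermal parametrizations *)

Lemma dot_conformal_basis (R : realType) (p q : 'rV[R]_4) (a b c d : R) :
  dot p p = - dot q q -> dot p q = 0 ->
  dot (a *: p + b *: q) (c *: p + d *: q) = dot p p * (a * c - b * d).
Proof.
move=> pp_qq pq0; have qqE : dot q q = - dot p p by rewrite pp_qq opprK.
by rewrite !dotDl !dotDr !dotZl !dotZr [dot q p]dotC pq0 qqE; ring.
Qed.

(** Here a, b, c are x_uu, x_uv, x_vv; the hypotheses are the u- and
v-derivatives of p^2 + q^2 = 0 and of p . q = 0.  For instance
a . p = - b . q = c . p, and a . q = - b . p = c . q. *)
Lemma conformal_laplacian_ortho (R : realType) (p q a b c : 'rV[R]_4) :
  dot a p + dot p a + (dot b q + dot q b) = 0 ->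
  dot b p + dot p b + (dot c q + dot q c) = 0 ->
  dot a q + dot p b = 0 -> dot b q + dot p c = 0 ->
  dot (a - c) p = 0 /\ dot (a - c) q = 0.
Proof.
rewrite -scaleN1r !dotDl !dotZl ![dot p _]dotC ![dot q _]dotC.
by move=> *; split; lra.
Qed.

Section SmoothMaps.
Variables (R : realType) (D : set (dblnum R)) (x : dblnum R -> 'rV[R]_4).
Hypotheses (openD : open D) (smooth_x : smooth_on D x).
Implicit Types t z : dblnum R.

Local Notation xu := (partial_u x).
Local Notation xv := (partial_v x).
Local Notation xuu := (partial_u xu).
Local Notation xuv := (partial_v xu).
Local Notation xvv := (partial_v xv).

Lemma near_domain t : D t -> \forall s \near t, D s.
Proof. by move=> Dt; apply: open_nbhs_nbhs. Qed.

Lemma smooth_differentiable t : D t -> differentiable x t.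
Proof. exact: (smooth_x [::]). Qed.

Lemma smooth_partial_u t : D t -> differentiable xu t.
Proof. exact: (smooth_x [:: 1]). Qed.

Lemma smooth_partial_v t : D t -> differentiable xv t.
Proof. exact: (smooth_x [:: 'j]). Qed.

Lemma mixed_partials t : D t -> partial_u xv t = xuv t.
Proof.
move=> Dt; apply/esym/derive_swap.
- apply: filterS (near_domain Dt) => s /smooth_differentiable xs.
  by split; exact: diff_derivable.
- exact: smooth_partial_u.
- exact: smooth_partial_v.
Qed.

(** Near t the tangent field of Y is Y_1 x_u + Y_2 x_v.  By the Leibniz rule the
derivatives k and l of its coefficients only enter through a tangent vector,
which the projection onto the normal plane kills. *)
Lemma derive_velocity (X Y : dblnum R -> dblnum R) t :
  D t -> derivable Y t (X t) -> exists k l : R,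
  'D_(X t) (fun s => 'd x s (Y s)) t
    = k *: xu t + l *: xv t
      + (((X t).1 * (Y t).1) *: xuu t
         + ((X t).1 * (Y t).2 + (X t).2 * (Y t).1) *: xuv t
         + ((X t).2 * (Y t).2) *: xvv t).
Proof.
move=> Dt Yd; have [Y1d Y2d] := derivable_coordinates Yd.
set k := 'D_(X t) (fun s => (Y s).1) t.
set l := 'D_(X t) (fun s => (Y s).2) t; exists k, l.
have near_t : \forall s \near t,
    (Y s).1 *: xu s + (Y s).2 *: xv s = 'd x s (Y s).
  apply: filterS (near_domain Dt) => s /smooth_differentiable xs.
  by rewrite differentiable_partials.
have du := derive_partials (X t) (smooth_partial_u Dt).
have dv := derive_partials (X t) (smooth_partial_v Dt).
have d1 := is_derive_scale (derivableP Y1d) du.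
have d2 := is_derive_scale (derivableP Y2d) dv.
have [_ ->] := near_eq_is_derive near_t (is_deriveD d1 d2).
have collect (a b p q r : 'rV[R]_4) (y1 y2 z1 z2 : R) :
    y1 *: (z1 *: p + z2 *: q) + k *: a + (y2 *: (z1 *: q + z2 *: r) + l *: b)
    = k *: a + l *: b
      + ((z1 * y1) *: p + (z1 * y2 + z2 * y1) *: q + (z2 * y2) *: r).
  by apply/matrixP => i j; rewrite !mxE; ring.
have -> : partial_u xv t = xuv t := mixed_partials Dt.
exact: collect.
Qed.

Hypothesis isothermal_x : isothermal D x.

Local Notation normal_proj t :=
  (proj_mx (normal_plane x t) (tangent_plane x t)).

Lemma second_fundamental_formE (X Y : dblnum R -> dblnum R) t :
  D t -> derivable Y t (X t) ->
  second_fundamental_form x X Y t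
    = ((X t).1 * (Y t).1) *: (xuu t *m normal_proj t)
      + ((X t).1 * (Y t).2 + (X t).2 * (Y t).1) *: (xuv t *m normal_proj t)
      + ((X t).2 * (Y t).2) *: (xvv t *m normal_proj t).
Proof.
move=> Dt Yd; have [k [l E]] := derive_velocity Dt Yd.
have [lt0 pq1 pq2] := isothermal_x Dt.
rewrite /second_fundamental_form E.
exact: normal_part_mod_tangent.
Qed.

Lemma induced_isothermal t (z w : dblnum R) : D t ->
  Defs.induced x t z w = dot (xu t) (xu t) * (z.1 * w.1 - z.2 * w.2).
Proof.
move=> Dt; have [_ pq1 pq2] := isothermal_x Dt.
rewrite /Defs.induced !(differentiable_partials _ (smooth_differentiable Dt)).
exact: dot_conformal_basis.
Qed.

(** The isothermality relations hold on the open set D, so they can be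
differentiated at t. *)
Lemma laplacian_ortho t : D t ->
  dot (hyperbolic_laplacian x t) (xu t) = 0
  /\ dot (hyperbolic_laplacian x t) (xv t) = 0.
Proof.
move=> Dt; have Dnear := near_domain Dt.
have xud z : is_derive t z xu ('D_z xu t).
  by split=> //; apply/diff_derivable/smooth_partial_u.
have xvd z : is_derive t z xv ('D_z xv t).
  by split=> //; apply/diff_derivable/smooth_partial_v.
have conf z : dot ('D_z xu t) (xu t) + dot (xu t) ('D_z xu t)
    + (dot ('D_z xv t) (xv t) + dot (xv t) ('D_z xv t)) = 0.
  have near0 : \forall s \near t, dot (xu s) (xu s) + dot (xv s) (xv s) = cst 0 s.
    by apply: filterS Dnear => s /isothermal_x[_ pq1 _]; apply/eqP;
      rewrite addr_eq0 pq1.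
  have d1 := is_deriveD (is_derive_dot (xud z) (xud z))
    (is_derive_dot (xvd z) (xvd z)).
  have [_ <-] := near_eq_is_derive near0 d1.
  exact: derive_cst.
have orth z : dot ('D_z xu t) (xv t) + dot (xu t) ('D_z xv t) = 0.
  have near0 : \forall s \near t, dot (xu s) (xv s) = cst 0 s.
    by apply: filterS Dnear => s /isothermal_x[_ _ ->].
  have [_ <-] := near_eq_is_derive near0 (is_derive_dot (xud z) (xvd z)).
  exact: derive_cst.
have vuE := mixed_partials Dt.
have cu : dot (xuu t) (xu t) + dot (xu t) (xuu t)
    + (dot (xuv t) (xv t) + dot (xv t) (xuv t)) = 0 by rewrite -vuE; exact: conf.
have cv : dot (xuv t) (xu t) + dot (xu t) (xuv t)
    + (dot (xvv t) (xv t) + dot (xv t) (xvv t)) = 0 := conf 'j.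
have ou : dot (xuu t) (xv t) + dot (xu t) (xuv t) = 0 by rewrite -vuE; exact: orth.
have ov : dot (xuv t) (xv t) + dot (xu t) (xvv t) = 0 := orth 'j.
exact: conformal_laplacian_ortho cu cv ou ov.
Qed.

End SmoothMaps.

(** * The equivalences *)

Lemma smooth_cst (R : realType) (W : normedModType R) (D : set (dblnum R))
    (w : W) : smooth_on D (cst w).
Proof.
move=> vs t _.
have [w' ->] : exists w' : W, foldr (fun v g => 'D_v g) (cst w) vs = cst w'.
  elim: vs => [|v vs [w' /= ->]]; first by exists w.
  by exists 0; apply/funext => s; exact: derive_cst.
exact: differentiable_cst.
Qed.

(** The trace computation behind the mean curvature.  The frame (x1, x2),
(y1, y2) is orthonormal for the form E (du^2 - dv^2), hence it is a hyperbolic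
rotation of the coordinate frame, up to scaling and signs: (y1, y2) = +- (x2, x1).  Thus the coefficient of the mixed term b
cancels. *)
Lemma frame_trace (R : realType) n (a b c : 'rV[R]_n) (E x1 x2 y1 y2 : R) :
  E < 0 -> E * (x1 * x1 - x2 * x2) = -1 -> E * (y1 * y1 - y2 * y2) = 1 ->
  E * (x1 * y1 - x2 * y2) = 0 ->
  2^-1 *: (- ((x1 * x1) *: a + (x1 * x2 + x2 * x1) *: b + (x2 * x2) *: c)
    + ((y1 * y1) *: a + (y1 * y2 + y2 * y1) *: b + (y2 * y2) *: c))
  = (2 * E)^-1 *: (a - c).
Proof.
move=> E_lt0 n1 n2 o12.
have E0 : E != 0 by rewrite lt_eqF.
have xy : x1 * y1 = x2 * y2.
  by apply/eqP; rewrite -subr_eq0; move/eqP: o12; rewrite mulf_eq0 (negPf E0).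
have nx : x1 * x1 - x2 * x2 = - E^-1.
  by apply: (mulfI E0); rewrite n1 mulrN divff.
have ny : y1 * y1 - y2 * y2 = E^-1 by apply: (mulfI E0); rewrite n2 divff.
have Ei : E^-1 < 0 by rewrite invr_lt0.
have x1_neq0 : x1 != 0.
  apply/eqP => x10; move: nx; rewrite x10 mul0r sub0r => /oppr_inj xE.
  by have := sqr_ge0 x2; rewrite expr2 xE leNgt Ei.
(* Multiply y1^2 - y2^2 = 1/E by x1^2 and replace x1 y1 by x2 y2. *)
have y2E : y2 * y2 = x1 * x1.
  have : x1 * x1 * (y1 * y1 - y2 * y2) = - (y2 * y2 * (x1 * x1 - x2 * x2)).
    have -> : x1 * x1 * (y1 * y1 - y2 * y2)
      = (x1 * y1) * (x1 * y1) - x1 * x1 * (y2 * y2) by ring.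
    by rewrite xy; ring.
  by rewrite nx ny mulrN opprK => /(mulIf (invr_neq0 E0)).
have y1E : y1 * y1 = x2 * x2 by lra.
have yyE : y1 * y2 = x1 * x2.
  apply: (mulfI x1_neq0); rewrite mulrA xy -mulrA y2E; ring.
have c1 : y1 * y1 - x1 * x1 = E^-1 by lra.
have c2 : y2 * y2 - x2 * x2 = - E^-1 by lra.
apply/matrixP => i j; rewrite !mxE invfM.
have -> : y2 * y1 = x1 * x2 by rewrite mulrC.
have -> : 2^-1 * E^-1 * (a i j - c i j)
  = 2^-1 * (E^-1 * a i j + - E^-1 * c i j) by ring.
rewrite yyE; congr (_ * _).
by rewrite -{1}c1 -c2; ring.
Qed.

Section Equivalences.
Variables (R : realType) (D : set (dblnum R)) (x : dblnum R -> 'rV[R]_4).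
Hypotheses (openD : open D) (smooth_x : smooth_on D x).
Implicit Types t z : dblnum R.

Local Notation xu := (partial_u x).
Local Notation xv := (partial_v x).
Local Notation xuu := (partial_u xu).
Local Notation xuv := (partial_v xu).
Local Notation xvv := (partial_v xv).

(** The second component x_vu - x_uv of the derivative vanishes by symmetry of
the mixed derivatives. *)
Lemma wirtinger_barPhi t i : D t ->
  wirtinger_bar (fun s => Phi x s 0 i) t
    = ((2^-1 * hyperbolic_laplacian x t 0 i, 0) : dblnum R).
Proof.
move=> Dt.
have PhiF : (fun s => Phi x s 0 i)
    = (fun s => (xu s 0 i, xv s 0 i) : dblnum R).
  by apply/funext => s; exact: PhiE.
have xud z : derivable xu t z by apply/diff_derivable/(smooth_partial_u smooth_x).
have xvd z : derivable xv t z by apply/diff_derivable/(smooth_partial_v smooth_x).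
have dPhi z : 'D_z (fun s => (xu s 0 i, xv s 0 i) : dblnum R) t
    = ((('D_z xu t) 0 i, ('D_z xv t) 0 i) : dblnum R).
  by have [_] := is_derive_pair (derive_coord 0 i (xud z))
    (derive_coord 0 i (xvd z)).
have cauchy_riemann (a b c : R) :
    2^-1 *: (((a, b) : dblnum R) - 'j * ((b, c) : dblnum R))
    = ((2^-1 * (a - c), 0) : dblnum R).
  have E1 : 2^-1 * (a - (0 * b + 1 * c)) = 2^-1 * (a - c) by ring.
  have E2 : 2^-1 * (b - (0 * c + 1 * b)) = 0 by ring.
  exact: (f_equal2 pair E1 E2).
have minusE (v w : 'rV[R]_4) : (v - w) 0 i = v 0 i - w 0 i by rewrite !mxE.
have vuE : partial_u xv t = xuv t := mixed_partials openD smooth_x Dt.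
have du : partial_u (fun s => (xu s 0 i, xv s 0 i) : dblnum R) t
    = ((xuu t 0 i, xuv t 0 i) : dblnum R) by rewrite -vuE; exact: (dPhi 1).
have dv : partial_v (fun s => (xu s 0 i, xv s 0 i) : dblnum R) t
    = ((xuv t 0 i, xvv t 0 i) : dblnum R) := dPhi 'j.
by rewrite /wirtinger_bar PhiF du dv cauchy_riemann /hyperbolic_laplacian minusE.
Qed.

Lemma holomorphic_harmonic :
  holomorphic_on D (Phi x) <-> hyperbolically_harmonic D x.
Proof.
split=> [hol|harm] t Dt; apply/matrixP => i j; rewrite ?ord1.
  have : (\row_i wirtinger_bar (fun s => Phi x s 0 i) t) 0 j = 0.
    by rewrite hol // mxE.
  rewrite mxE wirtinger_barPhi // => -[/eqP].
  by rewrite mulf_eq0 invr_eq0 pnatr_eq0 /= => /eqP ->; rewrite mxE.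
by rewrite mxE wirtinger_barPhi // harm // !mxE mulr0.
Qed.

Hypothesis isothermal_x : isothermal D x.

Local Notation normal_proj t :=
  (proj_mx (normal_plane x t) (tangent_plane x t)).

Lemma mean_curvatureE X1 X2 t :
  smooth_on D X1 -> smooth_on D X2 -> D t ->
  orthonormal_frame x t (X1 t) (X2 t) ->
  mean_curvature x X1 X2 t
    = (2 * dot (xu t) (xu t))^-1 *: (hyperbolic_laplacian x t *m normal_proj t).
Proof.
move=> sX1 sX2 Dt [].
rewrite !(induced_isothermal smooth_x isothermal_x) //.
have X1d : derivable X1 t (X1 t) by apply/diff_derivable/(sX1 [::]).
have X2d : derivable X2 t (X2 t) by apply/diff_derivable/(sX2 [::]).
have [E_lt0 _ _] := isothermal_x Dt.
rewrite /mean_curvature.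
rewrite !(second_fundamental_formE openD smooth_x isothermal_x Dt) //.
move=> n1 n2 o12; rewrite /hyperbolic_laplacian mulmxBl.
apply: frame_trace E_lt0 _ _ _; [exact: n1|exact: n2|exact: o12].
Qed.

(** For the converse the frame of constant fields proportional to the coordinate
fields suffices. *)
Lemma harmonic_minimal : timelike_surface D x ->
  hyperbolically_harmonic D x <-> minimal_timelike_surface D x.
Proof.
move=> timelike_x; split=> [harm|[_ minimal]].
  split=> // X1 X2 t sX1 sX2 Dt frame.
  by rewrite mean_curvatureE // harm // mul0mx scaler0.
move=> t Dt; have [E_lt0 pq1 pq2] := isothermal_x Dt.
have [ortho_u ortho_v] := laplacian_ortho openD smooth_x isothermal_x Dt.
(* x_u and x_v have squares E and -E, so dividing by sqrt (-E) normalizes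
   both. *)
pose r := (Num.sqrt (- dot (xu t) (xu t)))^-1.
have rr : dot (xu t) (xu t) * (r * r) = -1.
  have E_gt0 : 0 < - dot (xu t) (xu t) by rewrite oppr_gt0.
  rewrite /r -invfM -expr2 sqr_sqrtr ?ltW // invrN mulrN mulfV //.
  by rewrite lt_eqF.
pose X1 (s : dblnum R) : dblnum R := (r, 0).
pose X2 (s : dblnum R) : dblnum R := (0, r).
have sX1 : smooth_on D X1 by exact: (@smooth_cst _ _ _ ((r, 0) : dblnum R)).
have sX2 : smooth_on D X2 by exact: (@smooth_cst _ _ _ ((0, r) : dblnum R)).
have frame : orthonormal_frame x t (X1 t) (X2 t).
  split; rewrite (induced_isothermal smooth_x isothermal_x) //=.
  - by rewrite mulr0 subr0.
  - by rewrite mulr0 sub0r mulrN rr opprK.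
  - by rewrite mulr0 mul0r subr0 mulr0.
have := minimal X1 X2 t sX1 sX2 Dt frame.
rewrite mean_curvatureE // => /eqP; rewrite scaler_eq0 invr_eq0 mulf_eq0.
rewrite pnatr_eq0 (lt_eqF E_lt0) /= => /eqP normal0.
exact: normal_part_eq0_ortho normal0 ortho_u ortho_v.
Qed.

End Equivalences.

Theorem theorem4p1 (R : realType) (D : set (dblnum R))
    (x : dblnum R -> 'rV[R]_4)
    (openD : open D) (connectedD : connected D)
    (timelike_x : timelike_surface D x) (isothermal_x : isothermal D x) :
  (holomorphic_on D (Phi x) <-> hyperbolically_harmonic D x) /\
  (hyperbolically_harmonic D x <-> minimal_timelike_surface D x).
Proof.
have [smooth_x _] := timelike_x; split; first exact: holomorphic_harmonic.
exact: harmonic_minimal.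
Qed.
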